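(* Let $X$ be a compact linearly ordered topological space whose order is a well-order (for example, the ordinal space $X=[0,\kappa]$ for an ordinal $\kappa$). Then $X$ is $H_+$-rigid, that is, $H_+(X)=\{e\}$ (and thus $X$ is $aM_+$-compact).
   Context: A linearly ordered topological space is a set with a linear order equipped with the order topology. For a compact linearly ordered topological space $X$, $H_+(X)$ is the group of order-preserving homeomorphisms $X\to X$ with the compact-open topology; $e$ is its unit. $X$ is $H_+$-rigid if $H_+(X)$ is trivial. $X$ is $aM_+$-compact if $H_+(X)$ is $a$-minimal, i.e. its topology is the smallest Hausdorff group topology on the underlying group. *)

(* Defs.v *)
From HB Require Import structures.
From mathcomp Require Import all_boot all_order.
From mathcomp Require Import all_classical topology.

Set Implicit Arguments.
Unset Strict Implicit.
Unset Printing Implicit Defensive.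

Import Order.TTheory.

Local Open Scope classical_set_scope.

(* A group and a topology on the same carrier; no compatibility is assumed. *)
#[short(type="preTopologicalGroupType")]
HB.structure Definition PreTopologicalGroup := {G of Group G & Topological G}.

(* [Topological G] is the type of topologies on the carrier of [G], so that one
   group can carry several of them; [Topological.Pack tau] is the corresponding
   space. *)
Section GroupTopologies.
Variable G : groupType.

Definition group_topology (tau : Topological G) : Prop :=
  let T : topologicalType := Topological.Pack tau in
  continuous (fun z : T * T => ((z.1 : G) * (z.2 : G))%g : T) /\
  continuous (fun x : T => ((x : G)^-1)%g : T).

Definition hausdorff_group_topology (tau : Topological G) : Prop :=
  group_topology tau /\ hausdorff_space (Topological.Pack tau).

Definition coarser (tau sigma : Topological G) : Prop :=
  @open (Topological.Pack tau) `<=` @open (Topological.Pack sigma).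

End GroupTopologies.

Definition a_minimal (G : preTopologicalGroupType) : Prop :=
  let tau : Topological G := Topological.class G in
  hausdorff_group_topology tau /\
  forall sigma : Topological G, hausdorff_group_topology sigma ->
    coarser tau sigma.

Section OrderHomeomorphisms.
Context {d : Order.disp_t} (X : orderTopologicalType d).

Record Hplus := MkHplus {
  hfun :> X -> X;
  hinv : X -> X;
  hfunK : cancel hfun hinv;
  hinvK : cancel hinv hfun;
  hfun_continuous : continuous hfun;
  hinv_continuous : continuous hinv;
  hfun_homo : {homo hfun : x y / (x <= y)%O}
}.

Lemma Hplus_eqP (f g : Hplus) : hfun f =1 hfun g -> f = g.
Proof.
case: f g => [f f' fK f'K cf cf' mf] [g g' gK g'K cg cg' mg] /= fg.
have {}fg : f = g by apply/funext.
case: _ / fg in gK g'K cg mg *.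
have f'g' : f' = g'.
  by apply/funext => x; rewrite -[in LHS](g'K x) fK.
case: _ / f'g' in gK g'K cg cg' mg *.
by congr MkHplus; exact: Prop_irrelevance.
Qed.

Lemma hinv_homo (f : Hplus) : {homo hinv f : x y / (x <= y)%O}.
Proof.
move=> x y xy; rewrite leNgt; apply/negP => lt_yx.
have := hfun_homo f (ltW lt_yx); rewrite !hinvK => yx.
by move: lt_yx; rewrite (le_anti (introT andP (conj xy yx))) ltxx.
Qed.

Definition Hplus_one : Hplus.
Proof.
by apply: (@MkHplus idfun idfun) => // x; exact: cvg_id.
Defined.

Definition Hplus_mul (f g : Hplus) : Hplus.
Proof.
apply: (@MkHplus (f \o g) (hinv g \o hinv f)).
- exact: can_comp (hfunK f) (hfunK g).
- exact: can_comp (hinvK g) (hinvK f).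
- by move=> x; apply: continuous_comp; exact: hfun_continuous.
- by move=> x; apply: continuous_comp; exact: hinv_continuous.
- by move=> x y xy; do 2!apply: hfun_homo.
Defined.

Definition Hplus_inv (f : Hplus) : Hplus :=
  MkHplus (hinvK f) (hfunK f) (@hinv_continuous f) (@hfun_continuous f)
    (@hinv_homo f).

HB.instance Definition _ := gen_eqMixin Hplus.
HB.instance Definition _ := gen_choiceMixin Hplus.

Fact Hplus_mulA : associative Hplus_mul.
Proof. by move=> f g h; exact: Hplus_eqP. Qed.
Fact Hplus_1mul : left_id Hplus_one Hplus_mul.
Proof. by move=> f; exact: Hplus_eqP. Qed.
Fact Hplus_mul1 : right_id Hplus_one Hplus_mul.
Proof. by move=> f; exact: Hplus_eqP. Qed.
Fact Hplus_Vmul : left_inverse Hplus_one Hplus_inv Hplus_mul.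
Proof. by move=> f; apply: Hplus_eqP => x /=; rewrite hfunK. Qed.
Fact Hplus_mulV : right_inverse Hplus_one Hplus_inv Hplus_mul.
Proof. by move=> f; apply: Hplus_eqP => x /=; rewrite hinvK. Qed.

HB.instance Definition _ := isGroup.Build Hplus
  Hplus_mulA Hplus_1mul Hplus_mul1 Hplus_Vmul Hplus_mulV.

HB.instance Definition _ := Topological.copy Hplus
  (initial_topology (hfun : Hplus -> {compact-open, X -> X})).

Definition Hplus_rigid : Prop := [set: Hplus] = [set 1%g].

Definition aMplus_compact : Prop := a_minimal Hplus.

End OrderHomeomorphisms.

(* Main.v *)
(* If an order automorphism f of a well-order moves a point, let z be the least
   moved point. If f z < z then f fixes f z, so f z = z by injectivity; if
   z < f z then the same argument applies to the preimage of z, which lies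
   below z. On the resulting trivial group every topology has the same open
   sets, so minimality is automatic. *)

Require Import Defs.
From mathcomp Require Import all_boot all_order.
From mathcomp Require Import all_classical wochoice topology.

Import Order.TTheory.

Lemma Hplus_well_order_id (d : Order.disp_t) (X : orderTopologicalType d)
  (Xwo : well_order (fun x y : X => (x <= y)%O)) (f : Hplus X) : f =1 id.
Proof.
move=> x; apply: contrapT => fx.
have [|z [[zD zmin] _]] := Xwo [pred y : X | f y != y].
  by exists x; apply/eqP.
have fixed y : (y < z)%O -> f y = y.
  by move=> yz; apply/eqP; apply: contraTT yz => fy; rewrite -leNgt; exact: zmin.
have fz : f z != z by [].
case: (ltgtP (f z) z) => [fz_lt|z_lt|/eqP]; last by rewrite (negPf fz).
  by move: (fz_lt); rewrite (can_inj (hfunK f) (fixed _ fz_lt)) ltxx.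
(* Otherwise [z <= hinv f z], and applying the monotone [f] would give [f z <= z]. *)
have hz_lt : (hinv f z < z)%O.
  rewrite ltNge; apply/negP => /(hfun_homo f).
  by rewrite hinvK leNgt z_lt.
by have := fixed _ hz_lt; rewrite hinvK => zE; rewrite -zE ltxx in hz_lt.
Qed.

Lemma subsingleton_a_minimal (G : preTopologicalGroupType) :
  [set: G]%classic = [set 1%g]%classic -> a_minimal G.
Proof.
move=> G1.
have all1 (x y : G) : x = y.
  by have [-> ->] : [set 1%g]%classic x /\ [set 1%g]%classic y by rewrite -G1.
split.
  split; last by move=> x y _; exact: all1.
  split=> x.
    (* With one element, multiplication is a constant map, hence continuous although [G] assumes no
       compatibility with its topology. *)
    under eq_fun do rewrite (all1 (_ * _)%g 1%g).
    exact: cvg_cst.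
  under eq_fun do rewrite (all1 (_^-1)%g 1%g).
  exact: cvg_cst.
move=> sigma _ A _.
(* A subset of a one-point set is empty or everything, so it is open for any [sigma]. *)
have [[x Ax]|nA] := pselect (exists x, A x); last first.
  suff -> : A = classical_sets.set0 by exact: open0.
  by apply/seteqP; split=> // x Ax; apply: nA; exists x.
suff -> : A = classical_sets.setT by exact: openT.
by apply/seteqP; split=> // y _; rewrite (all1 y x).
Qed.

Theorem corollary4p4 (d : Order.disp_t) (X : orderTopologicalType d)
  (Xcompact : compact [set: X]%classic)
  (Xwo : well_order (fun x y : X => (x <= y)%O)) :
  Hplus_rigid X /\ aMplus_compact X.
Proof.
have rigid : Hplus_rigid X.
  apply/seteqP; split=> // f _.
  by apply: Hplus_eqP => x; exact: Hplus_well_order_id.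
by split=> //; exact: subsingleton_a_minimal.
Qed.
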